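(* The following three rules are sound for parametric acyclic causal teams, i.e. every parametric causal team with acyclic graph that satisfies the premises of an instance also satisfies its conclusion (here $\mathbf X,\mathbf Y$ are sets of variables, $W,X,Y$ variables, $\mathbf x,\mathbf y,w,x,x',y$ values in the respective ranges): $$(CE)\quad\frac{\mathbf X=\mathbf x\mathbin{\Box\!\!\rightarrow}W=w\qquad(\mathbf X=\mathbf x\wedge W=w)\mathbin{\Box\!\!\rightarrow}Y=y}{\mathbf X=\mathbf x\mathbin{\Box\!\!\rightarrow}Y=y}$$ $$(CI)\quad\frac{\mathbf X=\mathbf x\mathbin{\Box\!\!\rightarrow}W=w\qquad\mathbf X=\mathbf x\mathbin{\Box\!\!\rightarrow}Y=y}{(\mathbf X=\mathbf x\wedge W=w)\mathbin{\Box\!\!\rightarrow}Y=y}$$ $$(UNI)\quad\frac{\mathbf Y=\mathbf y\mathbin{\Box\!\!\rightarrow}X=x}{\mathbf Y=\mathbf y\mathbin{\Box\!\!\rightarrow}X\neq x'}\qquad(x\neq x').$$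
   Context: **Parametric causal teams.** A parametric causal team $T$ with finite set of variables $dom(T)$ is a quadruple $(T^-,G(T),\mathcal R_T,\mathcal F_T)$ where: $\mathcal R_T$ assigns to each $X\in dom(T)$ a set $Ran(X)$; $T^-$ is a set of assignments $s$ on $dom(T)$ with $s(X)\in Ran(X)$; $G(T)=(dom(T),E)$ is a directed graph, $PA_X=\{Y:(Y,X)\in E\}$; the set $\mathbf V$ of endogenous variables consists of the variables with $PA_X\ne\emptyset$; $\mathcal F_T$ assigns to each $Y\in\mathbf V$ a total function $f_Y:\prod_{X\in PA_Y}Ran(X)\to Ran(Y)$; and $s(Y)=f_Y(s(PA_Y))$ for all $s\in T^-$, $Y\in\mathbf V$. **Interventions.** For $\mathbf X\subseteq dom(T)$ let $d(\mathbf X,Z)$ be the maximal length of a directed path from some element of $\mathbf X$ to $Z$ (length $0$ allowed) in the graph obtained from $G(T)$ by deleting all arrows into $\mathbf X$, and $-1$ if there is none. $T_{\mathbf X=\mathbf x}$ is the causal team obtained from $T$ by: deleting all arrows into $\mathbf X$; setting $\mathbf X$ to $\mathbf x$ in every assignment; restricting the functional component to $\mathbf V\setminus\mathbf X$; then, for $n=1,2,\dots$ up to the maximal distance, simultaneously replacing in each assignment $s$ the values of all variables $Z$ with $d(\mathbf X,Z)=n$ by $f_Z(s(PA_Z))$. Ranges are unchanged. Interventions are defined for consistent conjunctions (the same variable always receives the same value); $\mathbf X=\mathbf x\wedge W=w$ denotes the simultaneous intervention. **Semantics.** $T\models Y=y$ iff $s(Y)=y$ for all $s\in T^-$; $T\models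 Y\neq y$ iff $s(Y)\neq y$ for all $s\in T^-$; $T\models\mathbf X=\mathbf x\mathbin{\Box\!\!\rightarrow}\chi$ iff $T_{\mathbf X=\mathbf x}\models\chi$; a counterfactual with inconsistent antecedent (containing $X_i=x_i$ and $X_i=x_i'$ with $x_i\ne x_i'$) is true by convention. *)

(* Defs.v *)
From HB Require Import structures.
From mathcomp Require Import all_boot all_order all_algebra.
From mathcomp Require Import classical_sets.
From Stdlib Require List.

Set Implicit Arguments.
Unset Strict Implicit.
Unset Printing Implicit Defensive.

Import Order.TTheory GRing.Theory Num.Theory.
Local Open Scope classical_set_scope.

Section Graph.
Variable V : finType.
Implicit Types (e : rel V) (D : {set V}).

(* [cycle e (x :: p)] is a closed walk through x, so this excludes loops too. *)
Definition acyclic e : Prop := forall c : seq V, cycle e c -> c = [::].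

Definition endogenous e (Y : V) : bool := [exists X, e X Y].

Definition del_arrows e D : rel V := [rel X Y | e X Y && (Y \notin D)].

Definition dpath e (X Z : V) (n : nat) : bool :=
  [exists p : n.-tuple V,
     [&& path e X p, uniq (X :: p) & last X p == Z]].

Definition dpath_from e D (Z : V) (n : nat) : bool :=
  [exists X in D, dpath (del_arrows e D) X Z n].

(* A directed path has no repeated vertex, hence length less than #|V|. *)
Definition dist e D (Z : V) : int :=
  if [exists n : 'I_#|V|, dpath_from e D Z n]
  then Posz (\max_(n < #|V| | dpath_from e D Z n) n)
  else (-1)%R.

Definition max_dist e D : nat := \max_(Z | (0 <= dist e D Z)%R) `|dist e D Z|%N.

Lemma del_endogenous e D Z : endogenous (del_arrows e D) Z -> endogenous e Z.
Proof. by case/existsP=> X /andP[eXZ _]; apply/existsP; exists X. Qed.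

Lemma del_endogenous_notin e D Z : endogenous (del_arrows e D) Z -> Z \notin D.
Proof. by case/existsP=> X /andP[]. Qed.

Lemma del_arrowsI e D X Z : e X Z -> Z \notin D -> del_arrows e D X Z.
Proof. by move=> eXZ ZD; apply/andP. Qed.

End Graph.

Section CausalTeams.
Variables (V : finType) (Ran : V -> Type).

Definition assignment := forall X : V, Ran X.

(* The argument tuples in the product of Ran(X), X in PA_Y, are the dependent
   functions [forall X, e X Y -> Ran X]. *)
Definition mechanisms (e : rel V) :=
  forall Y : V, endogenous e Y -> (forall X : V, e X Y -> Ran X) -> Ran Y.

Record preteam := Preteam {
  team : set assignment;
  graph : rel V;
  func : mechanisms graph
}.

Definition is_causal_team (T : preteam) : Prop :=
  forall s, team T s ->
  forall (Y : V) (endoY : endogenous (graph T) Y),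
    s Y = func endoY (fun X _ => s X).

(* The conjunction of the X = x for (X, x) in the list; a variable may occur
   several times, so inconsistent conjunctions are covered. *)
Definition conj_eq := seq {X : V & Ran X}.

Definition eq_atom (X : V) (x : Ran X) : {X : V & Ran X} := Tagged Ran x.

Definition vars (a : conj_eq) : {set V} := [set X in map tag a].

Definition consistent (a : conj_eq) : Prop :=
  forall (X : V) (x x' : Ran X),
    List.In (eq_atom x) a -> List.In (eq_atom x') a -> x = x'.

(* The first occurrence of a variable wins; for consistent conjunctions the
   order of the list is irrelevant. *)
Definition set_values (a : conj_eq) (s : assignment) : assignment :=
  fun X => foldr (fun u v => untag v (fun x : Ran X => x) u) (s X) a.

Section Intervention.
Variables (T : preteam) (a : conj_eq).

Definition do_graph : rel V := del_arrows (graph T) (vars a).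

(* Every endogenous variable of do_graph lies outside [vars a] and keeps all
   its parents. *)
Definition do_func : mechanisms do_graph := fun Z endoZ arg =>
  func (del_endogenous endoZ)
    (fun X eXZ => arg X (del_arrowsI eXZ (del_endogenous_notin endoZ))).

(* A variable at distance n >= 1 has a parent in do_graph, so it is never left
   unchanged for want of being endogenous. *)
Definition update (s : assignment) (n : nat) : assignment := fun Z =>
  if @idP (endogenous do_graph Z) is ReflectT endoZ then
    if dist (graph T) (vars a) Z == Posz n
    then do_func endoZ (fun X _ => s X) else s Z
  else s Z.

Definition do_assignment (s : assignment) : assignment :=
  foldl update (set_values a s) (iota 1 (max_dist (graph T) (vars a))).

Definition intervention : preteam :=
  Preteam (do_assignment @` team T) do_func.

End Intervention.

Inductive formula :=
| Eq (Y : V) (y : Ran Y)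
| Neq (Y : V) (y : Ran Y)
| Cf (a : conj_eq) (chi : formula).

Fixpoint sat (T : preteam) (phi : formula) : Prop :=
  match phi with
  | Eq Y y => forall s, team T s -> s Y = y
  | Neq Y y => forall s, team T s -> s Y <> y
  | Cf a chi => consistent a -> sat (intervention T a) chi
  end.

End CausalTeams.

Notation "T |== phi" := (sat T phi) (at level 70, no associativity).
Notation "a []-> chi" := (Cf a chi) (at level 60, right associativity).

(* Main.v *)
Require Import Defs.
From HB Require Import structures.
From mathcomp Require Import all_boot all_order all_algebra.
From mathcomp Require Import classical_sets.
From mathcomp Require Import boolp.
From Stdlib Require List.

(* In an acyclic team the intervened assignment is the unique assignment that
   takes the imposed values on the intervened variables, obeys the mechanisms
   on the other endogenous variables, and agrees with the original assignment
   on the remaining exogenous ones. If it already gives W the value w, then it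
   also solves the system of equations for the intervention extended by W = w,
   so the two interventions produce the same assignment. *)

Set Implicit Arguments.
Unset Strict Implicit.
Unset Printing Implicit Defensive.

(** * Directed paths and maximal distances in finite graphs *)

Lemma dpath_size (V : finType) (e : rel V) X Z n : dpath e X Z n -> n < #|V|.
Proof.
case/existsP=> p /and3P[_ Up _].
by have := max_card (mem (X :: p)); rewrite (card_uniqP Up) /= size_tuple.
Qed.

Section AcyclicGraph.
Variables (V : finType) (e : rel V).
Implicit Types D : {set V}.

(** A path without repeated vertices is shorter than [#|V|], so its length is among those over which
    [dist] takes its maximum. *)
Lemma dist_ge D Z n : dpath_from e D Z n -> exists2 m, n <= m & dist e D Z = Posz m.
Proof.
move=> pZ; have [X /andP[_ /dpath_size ltnV]] := existsP pZ.
rewrite /dist; case: existsP => [_|[]]; last by exists (Ordinal ltnV).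
by eexists; last reflexivity; apply: (leq_bigmax_cond (Ordinal ltnV)).
Qed.

Lemma dist_attained D Z n : dist e D Z = Posz n -> dpath_from e D Z n.
Proof.
rewrite /dist; case: existsP => // -[m pm] [<-].
by rewrite (bigmax_eq_arg m) //; case: arg_maxnP.
Qed.

Lemma dist_max D Z n : dist e D Z = Posz n -> n <= max_dist e D.
Proof.
move=> dZ; rewrite /max_dist.
by have := @leq_bigmax_cond _ (fun Z => (0 <= dist e D Z)%R)
  (fun Z => `|dist e D Z|%N) Z; rewrite dZ; apply.
Qed.

Lemma dist0 D Z : dist e D Z = Posz 0 -> Z \in D.
Proof.
by case/dist_attained/existsP=> X /andP[XD] /existsP[p]; rewrite tuple0 => /eqP <-.
Qed.

Lemma dist_in D Z : Z \in D -> exists n, dist e D Z = Posz n.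
Proof.
move=> ZD; have [|n _ dZ] := @dist_ge D Z 0; last by exists n.
apply/existsP; exists Z; rewrite ZD; apply/existsP; exists [tuple].
by rewrite /= eqxx.
Qed.

Lemma acyclic_path X p : acyclic e -> path e X p -> e (last X p) X -> False.
Proof. by move=> ae pX eX; have := ae (X :: p); rewrite /= rcons_path pX eX => /(_ isT). Qed.

(** Strong induction on the number of vertices from which [Z] can be reached: all those reaching a
    parent also reach [Z], and [Z] itself is lost, since it could reach its parent only along a
    cycle. *)
Lemma acyclic_ind (P : V -> Prop) : acyclic e ->
  (forall Z, (forall X, e X Z -> P X) -> P Z) -> forall Z, P Z.
Proof.
move=> ae IH Z; have [n] := ubnP #|[pred X : V | connect e X Z]|.
elim: n Z => // n IHn Z leZn; apply: IH => X eXZ; apply: IHn.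
apply: leq_trans (leZn : _ <= n); apply: proper_card.
apply/properP; split.
  apply/fintype.subsetP=> U; rewrite !inE => cUX.
  exact: connect_trans cUX (connect1 eXZ).
exists Z; rewrite !inE ?connect0 //.
by apply/negP => /connectP[p pZ lastX]; apply: (acyclic_path ae pZ); rewrite -lastX.
Qed.

Lemma dpath_from_edge D X Z n : acyclic e ->
  del_arrows e D X Z -> dpath_from e D X n -> dpath_from e D Z n.+1.
Proof.
move=> ae eXZ /existsP[U /andP[UD /existsP[p /and3P[pX Up /eqP lastX]]]].
apply/existsP; exists U; rewrite UD; apply/existsP.
exists [tuple of rcons p Z].
rewrite /= last_rcons eqxx andbT rcons_path pX lastX eXZ /=.
rewrite -[_ && _]/(uniq (rcons (U :: p) Z)) rcons_uniq Up andbT; apply/negP=> Zp.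
have [eXZ' _] := andP eXZ.
have sub : subrel (del_arrows e D) e by move=> ? ? /andP[].
(* Were [Z] on the path already, its part from [Z] to [X] would close to a cycle with the arrow from
   [X] to [Z]. *)
move: (tval p) Zp (sub_path sub pX) lastX => q /splitPl[p1 p2 lastZ].
rewrite cat_path last_cat lastZ => /andP[_ p2Z] lastX.
by apply: (acyclic_path ae p2Z); rewrite lastX.
Qed.

(** A longest path to the parent is prolonged by the arrow. Hence a reachable parent is updated
    strictly before its child. *)
Lemma dist_parent D X Z n : acyclic e -> del_arrows e D X Z -> dist e D X = Posz n ->
  exists2 m, n < m & dist e D Z = Posz m.
Proof. by move=> ae eXZ /dist_attained /(dpath_from_edge ae eXZ) /dist_ge. Qed.

End AcyclicGraph.

Section Interventions.
Variables (V : finType) (Ran : V -> Type).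
Implicit Types (T : preteam Ran) (a : conj_eq Ran) (s t : assignment Ran).

(** * Values imposed by a conjunction, and consistency *)

Lemma untag_atom R0 (d : R0) X (x : Ran X) (F : Ran X -> R0) :
  untag d F (eq_atom x) = F x.
Proof. exact: (@untagE _ _ _ d X F (eq_atom x) erefl). Qed.

Lemma set_values_cons X (x : Ran X) a s :
  set_values (eq_atom x :: a) s X = x.
Proof. by rewrite /set_values /= untag_atom. Qed.

Lemma set_values_notin a s X : X \notin vars a -> set_values a s X = s X.
Proof.
rewrite inE /set_values; elim: a => //= u a IH.
rewrite inE negb_or eq_sym => /andP[uX /IH ->].
exact: untag_dflt.
Qed.

(** The first occurrence of a variable wins, so an equation appended at the end cannot override an
    earlier one. *)
Lemma set_values_rcons_in a W (w : Ran W) s X : X \in vars a ->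
  set_values (rcons a (eq_atom w)) s X = set_values a s X.
Proof.
rewrite inE /set_values; elim: a => //= u a IH.
rewrite inE eq_sym; have [<- _|uX /= /IH ->//] := eqVneq.
by case: u => U u; rewrite !untag_atom.
Qed.

Lemma set_values_rcons_notin a W (w : Ran W) s : W \notin vars a ->
  set_values (rcons a (eq_atom w)) s W = w.
Proof.
rewrite inE /set_values; elim: a => [_|u a IH] /=.
  by rewrite untag_atom.
rewrite inE negb_or eq_sym => /andP[uX /IH ->].
exact: untag_dflt.
Qed.

Lemma set_values_atom a X : X \in vars a ->
  forall s, List.In (eq_atom (set_values a s X)) a.
Proof.
move=> + s; rewrite inE; elim: a => //= -[U u] a IH.
rewrite inE; have [XU _|XU /= /IH aX] := eqVneq.
  rewrite /= in XU; case: U / XU u => u; left; congr existT.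
  exact: esym (set_values_cons _ _ _).
right; rewrite /set_values /= untag_dflt // eq_sym.
exact: XU.
Qed.

Lemma in_vars a X (x : Ran X) : List.In (eq_atom x) a -> X \in vars a.
Proof.
by rewrite inE; elim: a => //= u a IH [->|/IH]; rewrite inE ?eqxx // => ->; rewrite orbT.
Qed.

Lemma in_rcons a (u v : {X : V & Ran X}) :
  List.In u (rcons a v) <-> List.In u a \/ v = u.
Proof.
elim: a => [|v' a IH] /=; first by split=> [[->|//]|[//|->]]; [right|left].
by rewrite IH; tauto.
Qed.

Lemma vars_rcons a W (w : Ran W) X :
  (X \in vars (rcons a (eq_atom w))) = (X == W) || (X \in vars a).
Proof. by rewrite !inE map_rcons mem_rcons inE. Qed.

Lemma satisfied_consistent a t :
  (forall X (x : Ran X), List.In (eq_atom x) a -> t X = x) -> consistent a.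
Proof. by move=> ta X x x' /ta <- /ta <-. Qed.

Lemma consistent_rcons a u : consistent (rcons a u) -> consistent a.
Proof.
by move=> ca X x x' ax ax'; apply: ca; apply/in_rcons; left.
Qed.

(** * Stagewise updates and the equations satisfied by their result *)

Lemma do_endogenous T a Z : endogenous (graph T) Z -> Z \notin vars a ->
  endogenous (do_graph T a) Z.
Proof.
by move=> /existsP[X eXZ] Za; apply/existsP; exists X; apply: del_arrowsI.
Qed.

(* [update] matches on [@idP b] with [b] occurring in both branches, which blocks
   dependent case analysis; decoupling the proposition from [b] restores it. *)
Lemma if_reflectP (P : Prop) b (r : reflect P b) (A : Type) (f : P -> A) g :
  (exists p, (if r is ReflectT q then f q else g) = f p) \/
  (~ P /\ (if r is ReflectT q then f q else g) = g).
Proof. by case: r => [p|nP]; [left; exists p | right]. Qed.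

Lemma update_cases T a s n Z :
  (exists endoZ : endogenous (do_graph T a) Z, update T a s n Z =
     if dist (graph T) (vars a) Z == Posz n
     then do_func endoZ (fun X _ => s X) else s Z) \/
  (~ endogenous (do_graph T a) Z /\ update T a s n Z = s Z).
Proof.
exact: (if_reflectP (@idP (endogenous (do_graph T a) Z))
  (fun endoZ => if dist (graph T) (vars a) Z == Posz n
    then do_func endoZ (fun X _ => s X) else s Z) (s Z)).
Qed.

Lemma updateE T a s n Z (endoZ : endogenous (graph T) Z) :
  Z \notin vars a -> dist (graph T) (vars a) Z = Posz n ->
  update T a s n Z = func endoZ (fun X _ => s X).
Proof.
move=> Za dZ; have [[endo ->]|[[]]] := update_cases T a s n Z; last exact: do_endogenous.
(* The two proofs that [Z] is endogenous differ syntactically; they are equal because the property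
   is boolean. *)
by rewrite dZ eqxx /do_func (bool_irrelevance (del_endogenous _) endoZ).
Qed.

Lemma update_id T a s n Z :
  dist (graph T) (vars a) Z <> Posz n -> update T a s n Z = s Z.
Proof.
move=> /eqP/negPf dZ; have [[? ->]|[_ ->]//] := update_cases T a s n Z.
by rewrite dZ.
Qed.

Lemma update_exogenous T a s n Z :
  ~~ endogenous (do_graph T a) Z -> update T a s n Z = s Z.
Proof.
by move=> /negP exoZ; have [[endoZ]|[]] := update_cases T a s n Z => //.
Qed.

(** The assignment after the first [n] rounds; for [n] the maximal distance it is [do_assignment] by
    conversion. *)
Definition do_stage T a s n := foldl (update T a) (set_values a s) (iota 1 n).

Lemma do_stageS T a s n :
  do_stage T a s n.+1 = update T a (do_stage T a s n) n.+1.
Proof. by rewrite /do_stage -[in LHS](addn1 n) iotaD foldl_cat add1n. Qed.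

(* Each variable is updated at most once, at the stage equal to its distance. *)
Lemma do_stage_stable T a s m n X : m <= n ->
  (forall k, dist (graph T) (vars a) X = Posz k -> k <= m) ->
  do_stage T a s n X = do_stage T a s m X.
Proof.
move=> lemn dX; elim: n lemn => [|n IH]; first by rewrite leqn0 => /eqP->.
rewrite leq_eqVlt => /orP[/eqP->//|ltmn]; rewrite do_stageS update_id ?IH //.
by move=> /dX; rewrite leqNgt ltmn.
Qed.

Lemma do_assignment_exogenous T a s Z :
  ~~ endogenous (do_graph T a) Z -> do_assignment T a s Z = set_values a s Z.
Proof.
move=> exoZ; rewrite -[LHS]/(do_stage _ _ _ _ Z); elim: max_dist => // n IH.
by rewrite do_stageS update_exogenous.
Qed.

Lemma do_assignment_vars T a s Z :
  Z \in vars a -> do_assignment T a s Z = set_values a s Z.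
Proof.
move=> Za; apply: do_assignment_exogenous.
by apply/negP => /del_endogenous_notin; rewrite Za.
Qed.

(** When [Z] is updated, at the stage given by its distance, all its parents already have their
    final values. *)
Lemma do_assignment_func T a s Z (endoZ : endogenous (graph T) Z) :
  acyclic (graph T) -> is_causal_team T -> team T s -> Z \notin vars a ->
  do_assignment T a s Z = func endoZ (fun X _ => do_assignment T a s X).
Proof.
move=> aT cT Ts Za; rewrite -[LHS]/(do_stage _ _ _ _ Z).
have argE t t' : (forall X, graph T X Z -> t X = t' X) ->
    func endoZ (fun X _ => t X) = func endoZ (fun X _ => t' X).
  by move=> tt'; congr func; do 2!apply: functional_extensionality_dep => ?; apply: tt'.
have parent X n : graph T X Z -> dist (graph T) (vars a) X = Posz n ->
    exists2 m, n < m & dist (graph T) (vars a) Z = Posz m.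
  by move=> eXZ; apply: dist_parent => //; apply: del_arrowsI.
case dZ: (dist (graph T) (vars a) Z) => [[|n]|n].
- by rewrite (dist0 dZ) in Za.
- rewrite (do_stage_stable _ (dist_max dZ)); last by rewrite dZ => k [<-].
  (* The update at stage [n.+1] reads the parents at stage [n]; their distances are at most [n], so
     these values are final. *)
  rewrite do_stageS (updateE _ _ Za dZ); apply: argE => X eXZ.
  rewrite -[RHS]/(do_stage _ _ _ _ X) (@do_stage_stable _ _ _ n _) //.
    exact: ltnW (dist_max dZ).
  by move=> k /(parent _ _ eXZ)[m ltkm]; rewrite dZ => -[Em]; rewrite -ltnS Em.
(* No parent of an unreachable variable is reachable, so the equation of [s] at
   [Z] survives unchanged. *)
- rewrite (@do_stage_stable _ _ _ 0 _) //; last by rewrite dZ.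
  rewrite /do_stage /= set_values_notin // (cT s Ts Z endoZ).
  apply: argE => X eXZ.
  have dX k : dist (graph T) (vars a) X <> Posz k.
    by move=> /(parent _ _ eXZ)[m _]; rewrite dZ.
  rewrite -[RHS]/(do_stage _ _ _ _ X) (@do_stage_stable _ _ _ 0 _) //.
    by rewrite /do_stage /= set_values_notin //; apply/negP=> /(dist_in (graph T))[k /dX].
  by move=> k /dX.
Qed.

(** * Uniqueness of the solution, and antecedents extended by one equation *)

Lemma do_assignment_unique T a s t :
  acyclic (graph T) -> is_causal_team T -> team T s ->
  (forall Z, Z \in vars a -> t Z = set_values a s Z) ->
  (forall Z, ~~ endogenous (graph T) Z -> Z \notin vars a -> t Z = s Z) ->
  (forall Z (endoZ : endogenous (graph T) Z), Z \notin vars a ->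
     t Z = func endoZ (fun X _ => t X)) ->
  do_assignment T a s = t.
Proof.
move=> aT cT Ts t_vars t_exo t_func; apply: functional_extensionality_dep.
apply: (acyclic_ind aT) => Z IH.
have [Za|Za] := boolP (Z \in vars a); first by rewrite do_assignment_vars // t_vars.
have [endoZ|exoZ] := boolP (endogenous (graph T) Z).
  rewrite (do_assignment_func endoZ) // (t_func _ endoZ) //; congr func.
  by do 2!apply: functional_extensionality_dep => ?; apply: IH.
rewrite t_exo // do_assignment_exogenous ?set_values_notin //.
by apply: contra exoZ => /del_endogenous.
Qed.

Lemma do_assignment_rcons T a s W (w : Ran W) :
  acyclic (graph T) -> is_causal_team T -> team T s ->
  do_assignment T a s W = w ->
  do_assignment T (rcons a (eq_atom w)) s = do_assignment T a s.
Proof.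
move=> aT cT Ts doW; apply: do_assignment_unique => // Z.
(* If [Z] occurs in [a], the appended equation is ignored; otherwise [Z] is [W], and the two values
   agree by [doW]. *)
- rewrite vars_rcons; have [Za _|Za] := boolP (Z \in vars a).
    by rewrite set_values_rcons_in // do_assignment_vars.
  by rewrite orbF => /eqP ZW; subst Z; rewrite set_values_rcons_notin.
- rewrite vars_rcons negb_or => exoZ /andP[_ Za].
  rewrite do_assignment_exogenous ?set_values_notin //.
  by apply: contra exoZ => /del_endogenous.
- by move=> endoZ; rewrite vars_rcons negb_or => /andP[_ Za]; apply: do_assignment_func.
Qed.

Lemma do_assignment_satisfies T a s X (x : Ran X) :
  consistent a -> List.In (eq_atom x) a -> do_assignment T a s X = x.
Proof.
move=> ca ax; have Xa := in_vars ax.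
by rewrite do_assignment_vars //; apply: ca ax; apply: set_values_atom.
Qed.

(** Equations with a common solution are consistent, and the intervened assignment solves all of
    them. *)
Lemma consistent_rcons_do T a s W (w : Ran W) : consistent a ->
  do_assignment T a s W = w -> consistent (rcons a (eq_atom w)).
Proof.
move=> ca doW; apply: (@satisfied_consistent _ (do_assignment T a s)) => X x.
case/in_rcons=> [|wx]; first exact: do_assignment_satisfies.
have WX : W = X := congr1 tag wx.
(* Applying [untag] to both sides of [wx] extracts the equality of the second components. *)
by subst X; rewrite doW -(untag_atom w w id) wx untag_atom.
Qed.

End Interventions.

Theorem theorem4p10 (V : finType) (Ran : V -> Type) (T : preteam Ran)
    (T_causal : is_causal_team T) (T_acyclic : acyclic (graph T)) :
  (* (CE) *)
  (forall (Xx : conj_eq Ran) (W : V) (w : Ran W) (Y : V) (y : Ran Y),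
      T |== (Xx []-> Eq w) ->
      T |== (rcons Xx (eq_atom w) []-> Eq y) ->
      T |== (Xx []-> Eq y)) /\
  (* (CI) *)
  (forall (Xx : conj_eq Ran) (W : V) (w : Ran W) (Y : V) (y : Ran Y),
      T |== (Xx []-> Eq w) ->
      T |== (Xx []-> Eq y) ->
      T |== (rcons Xx (eq_atom w) []-> Eq y)) /\
  (* (UNI) *)
  (forall (Yy : conj_eq Ran) (X : V) (x x' : Ran X),
      x <> x' ->
      T |== (Yy []-> Eq x) ->
      T |== (Yy []-> Neq x')).
Proof.
split; [|split].
- move=> a W w Y y satW satY ca _ [s Ts <-].
  have doW : do_assignment T a s W = w by apply: satW => //; exists s.
  rewrite -(do_assignment_rcons T_acyclic T_causal Ts doW).
  (* The second premise of (CE) is informative only for a consistent antecedent; consistency is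
     witnessed by the intervened [s]. *)
  by apply: satY; [apply: consistent_rcons_do ca doW | exists s].
- move=> a W w Y y satW satY /consistent_rcons ca _ [s Ts <-].
  have doW : do_assignment T a s W = w by apply: satW => //; exists s.
  by rewrite do_assignment_rcons //; apply: satY => //; exists s.
- by move=> a X x x' xx' satX ca s Ts sx'; apply: xx'; rewrite -sx' (satX ca s Ts).
Qed.
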